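(* Let $0<\varepsilon<1$. Assume that $u, -v \in \mathrm{USC}(\bar\Omega)$ satisfy $$-\Delta_\infty^\varepsilon u \leq -\Delta_\infty^\varepsilon v \quad \text{in } \Omega .$$ Suppose also that $u$ has no strict $\varepsilon$-local maximum in $\Omega$, or $v$ has no strict $\varepsilon$-local minimum in $\Omega$. Then $$\max_{\bar\Omega}(u-v)=\max_{\partial\Omega}(u-v).$$
   Context: $\Omega\subseteq\mathbb{R}^n$ is a bounded, connected, open set. For $x,y\in\bar\Omega$, $d(x,y)$ is the path distance: the infimum of the lengths of Lipschitz paths $\gamma:[0,1]\to\bar\Omega$ with $\gamma(0)=x$, $\gamma(1)=y$. It is assumed that $\operatorname{diam}(\Omega):=\sup\{d(x,y):x,y\in\bar\Omega\}<\infty$. For $E\subseteq\bar\Omega$, $\operatorname{dist}(x,E):=\inf\{d(x,y):y\in E\}$. Write $\bar\Omega(x,r):=\{y\in\bar\Omega: d(x,y)\le r\}$. $\mathrm{USC}(\bar\Omega)$ is the set of upper semicontinuous real-valued functions on $\bar\Omega$. For $\varepsilon>0$ set $\rho_\varepsilon(x,y):=\max\{d(x,y),\varepsilon\}$ if $x,y\in\Omega$, and $\rho_\varepsilon(x,y):=d(x,y)$ if $x\in\partial\Omega$ or $y\in\partial\Omega$. For $u:\bar\Omega\to\mathbb{R}$ and $x\in\Omega$, $$S^+_\varepsilon u(x):=\sup_{y\in\bar\Omega(x,\varepsilon)}\frac{u(y)-u(x)}{\rho_\varepsilon(x,y)},\quad S^-_\varepsilon u(x):=\sup_{y\in\bar\Omega(x,\varepsilon)}\frac{u(x)-u(y)}{\rho_\varepsilon(x,y)},\quad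 \Delta^\varepsilon_\infty u(x):=\frac1\varepsilon\big(S^+_\varepsilon u(x)-S^-_\varepsilon u(x)\big).$$ Inequalities involving $\Delta^\varepsilon_\infty$ are understood pointwise. A point $x\in\Omega$ is a strict $\varepsilon$-local maximum of $w:\bar\Omega\to\mathbb{R}$ if there is a closed set $F\subseteq\Omega$ with $x\in F$ and $w(x)=\sup_F w>w(y)$ for every $y\in F^\varepsilon\setminus F$, where $F^\varepsilon:=\{z\in\bar\Omega:\operatorname{dist}(z,F)\le\varepsilon\}$. A point $x$ is a strict $\varepsilon$-local minimum of $w$ if it is a strict $\varepsilon$-local maximum of $-w$. *)

(* Defs.v *)
From HB Require Import structures.
From mathcomp Require Import all_boot all_order all_algebra.
From mathcomp Require Import all_classical all_reals all_analysis.

Set Implicit Arguments.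
Unset Strict Implicit.
Unset Printing Implicit Defensive.

Import Order.TTheory GRing.Theory Num.Theory.
Import numFieldNormedType.Exports.

Local Open Scope classical_set_scope.
Local Open Scope ring_scope.

(* The canonical norm on 'rV[R]_n is the sup norm; lengths of paths need the
   Euclidean one. Both induce the same topology and the same bounded sets. *)
Definition enorm (R : realType) (n : nat) (x : 'rV[R]_n) : R :=
  Num.sqrt (\sum_(i < n) x ord0 i ^+ 2).

Definition lipschitz_path (R : realType) (n : nat) (g : R -> 'rV[R]_n) : Prop :=
  exists k : R, forall s t : R, `[0, 1]%classic s -> `[0, 1]%classic t ->
    enorm (g s - g t) <= k * `|s - t|.

(* A partition s lists the points of the subdivision after 0, the last being
   1; the i-th step goes from (0 :: s)_i to s_i. *)
Definition path_variation (R : realType) (n : nat) (g : R -> 'rV[R]_n)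
    (s : seq R) : R :=
  \sum_(i < size s) enorm (g (nth 1 s i) - g (nth 1 (0 :: s) i)).

Definition path_length (R : realType) (n : nat) (g : R -> 'rV[R]_n) : \bar R :=
  ereal_sup [set (path_variation g s)%:E | s in itv_partition 0 1].

(* The infimum is +oo when x and y are not joined by any admissible path. *)
Definition path_dist (R : realType) (n : nat) (Omega : set 'rV[R]_n)
    (x y : 'rV[R]_n) : \bar R :=
  ereal_inf [set path_length g | g in [set g : R -> 'rV[R]_n |
    [/\ lipschitz_path g,
        (forall t, `[0, 1]%classic t -> closure Omega (g t)),
        g 0 = x & g 1 = y]]].

Definition path_diam (R : realType) (n : nat) (Omega : set 'rV[R]_n) : \bar R :=
  ereal_sup [set path_dist Omega p.1 p.2 |
    p in closure Omega `*` closure Omega].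

Definition dist_to (R : realType) (n : nat) (Omega : set 'rV[R]_n)
    (x : 'rV[R]_n) (E : set 'rV[R]_n) : \bar R :=
  ereal_inf [set path_dist Omega x y | y in E].

Definition path_ball (R : realType) (n : nat) (Omega : set 'rV[R]_n)
    (x : 'rV[R]_n) (r : R) : set 'rV[R]_n :=
  [set y | closure Omega y /\ (path_dist Omega x y <= r%:E)%E].

Definition boundary (T : topologicalType) (A : set T) : set T :=
  closure A `\` interior A.

(* Functions on A are represented by total functions whose values outside A
   are irrelevant: every point outside A is isolated in [subspace A]. *)
Definition usc_on (T : topologicalType) (R : realType) (A : set T)
    (u : T -> R) : Prop :=
  lower_semicontinuous (fun x : subspace A => (- u x)%:E).

(* On closure Omega, the second case means that x or y is on the boundary.
   Taking [fine] is harmless when path_diam is finite. *)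
Definition rho (R : realType) (n : nat) (Omega : set 'rV[R]_n) (eps : R)
    (x y : 'rV[R]_n) : R :=
  if (x \in Omega) && (y \in Omega) then Num.max (fine (path_dist Omega x y)) eps
  else fine (path_dist Omega x y).

(* The slopes are extended reals: for u merely upper semicontinuous, u may be
   unbounded below, and slope_minus u x may be +oo. *)
Definition slope_plus (R : realType) (n : nat) (Omega : set 'rV[R]_n) (eps : R)
    (u : 'rV[R]_n -> R) (x : 'rV[R]_n) : \bar R :=
  ereal_sup [set ((u y - u x) / rho Omega eps x y)%:E |
    y in path_ball Omega x eps].

Definition slope_minus (R : realType) (n : nat) (Omega : set 'rV[R]_n) (eps : R)
    (u : 'rV[R]_n -> R) (x : 'rV[R]_n) : \bar R :=
  ereal_sup [set ((u x - u y) / rho Omega eps x y)%:E |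
    y in path_ball Omega x eps].

(* If u or - u is upper semicontinuous on the compact closure of Omega, at most
   one of the two slopes is infinite, so the difference is never oo - oo. *)
Definition inf_laplace (R : realType) (n : nat) (Omega : set 'rV[R]_n) (eps : R)
    (u : 'rV[R]_n -> R) (x : 'rV[R]_n) : \bar R :=
  ((eps^-1)%:E * (slope_plus Omega eps u x - slope_minus Omega eps u x))%E.

Definition neighborhood (R : realType) (n : nat) (Omega : set 'rV[R]_n)
    (F : set 'rV[R]_n) (eps : R) : set 'rV[R]_n :=
  [set z | closure Omega z /\ (dist_to Omega z F <= eps%:E)%E].

Definition strict_local_max (R : realType) (n : nat) (Omega : set 'rV[R]_n)
    (eps : R) (w : 'rV[R]_n -> R) (x : 'rV[R]_n) : Prop :=
  exists F : set 'rV[R]_n,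
    [/\ closed F, F `<=` Omega, F x,
        (w x)%:E = ereal_sup [set (w z)%:E | z in F] &
        forall y, (neighborhood Omega F eps `\` F) y -> w y < w x].

Definition strict_local_min (R : realType) (n : nat) (Omega : set 'rV[R]_n)
    (eps : R) (w : 'rV[R]_n -> R) (x : 'rV[R]_n) : Prop :=
  strict_local_max Omega eps (\- w) x.

Definition is_max_on (T : Type) (R : realType) (A : set T) (f : T -> R)
    (m : R) : Prop :=
  (f @` A) m /\ ubound (f @` A) m.

(* Main.v *)
Require Import Defs.
From HB Require Import structures.
From mathcomp Require Import all_boot all_order all_algebra.
From mathcomp Require Import all_classical all_reals all_analysis.
From mathcomp Require Import ring lra.

Set Implicit Arguments.
Unset Strict Implicit.
Unset Printing Implicit Defensive.

Import Order.TTheory GRing.Theory Num.Theory.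
Import numFieldNormedType.Exports.

Local Open Scope classical_set_scope.
Local Open Scope ring_scope.

(** Let M be the maximum of u - v over the compact closure of Omega (both u and
  - v are upper semicontinuous), let E be the set where it is attained, and
  suppose that E misses the boundary, so that E is a compact subset of Omega.

  At a point x of E one has u y - u x <= v y - v x for all y. Hence the upward
  slope of u at x is at most that of v, and the downward slope of u is at least
  that of v; the inequality between the infinity Laplacians then forces both
  pairs of slopes to agree and to be finite ([slopes_eq_at_max]).

  Take u without strict local maximum. Let F be the set where u attains its
  maximum over E. As F is not the witness of a strict local maximum, some y
  outside F, at distance at most eps from F, has u y >= max_E u; such a y lies
  outside E. The point x of F nearest to y exists ([nearest_point]) because
  F is compact and segments inside Omega make the path distance lower
  semicontinuous there. Since y is not in E, v y - v x > u y - u x >= 0, so the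
  upward slope of v at x is positive, and so is that of u.

  This is impossible: equality of two positive upward slopes at a point of E
  produces another point of E with a larger value of u ([slope_plus_ascent]),
  whereas x maximizes u over E. The idea there is that near-optimal points y for
  the slope of u satisfy u y >= u x + const > u x; if the compact set of all such
  points missed E, then u - v would stay below M by a fixed amount on it, and the
  slope of v would exceed that of u.

  When it is v that has no strict local minimum, the same argument applies to
  the pair (- v, - u), whose difference is again u - v and whose upward slopes
  are the downward slopes of v and u. *)

(** * The Euclidean norm *)

Section Enorm.
Variables (R : realType) (n : nat).
Implicit Types x y z : 'rV[R]_n.

Lemma enorm_ge0 x : 0 <= enorm x.
Proof. exact: sqrtr_ge0. Qed.

Lemma enorm_sqr x : enorm x ^+ 2 = \sum_(i < n) x ord0 i ^+ 2.
Proof. by rewrite sqr_sqrtr// sumr_ge0// => i _; exact: sqr_ge0. Qed.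

Lemma coord_le_enorm x i : `|x ord0 i| <= enorm x.
Proof.
rewrite -(@ler_pXn2r _ 2) ?nnegrE ?enorm_ge0// real_normK ?num_real//.
rewrite enorm_sqr (bigD1 i)//= lerDl sumr_ge0// => j _; exact: sqr_ge0.
Qed.

Lemma enormZ (a : R) x : enorm (a *: x) = `|a| * enorm x.
Proof.
rewrite /enorm -sqrtr_sqr -sqrtrM ?sqr_ge0// mulr_sumr.
by congr Num.sqrt; apply: eq_bigr => i _; rewrite mxE exprMn.
Qed.

Lemma enorm0 : enorm (0 : 'rV[R]_n) = 0.
Proof. by rewrite -(scale0r 0) enormZ normr0 mul0r. Qed.

Lemma enormN x : enorm (- x) = enorm x.
Proof. by rewrite -scaleN1r enormZ normrN1 mul1r. Qed.

Lemma enormBC x y : enorm (x - y) = enorm (y - x).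
Proof. by rewrite -enormN opprB. Qed.

(** Expanding the sum of the squares of |y| x_i - |x| y_i, which is nonnegative,
  gives 2 |x| |y| (|x| |y| - <x, y>). Dividing by |x| |y| requires treating the
  zero vectors apart. *)
Lemma enorm_cauchy_schwarz x y :
  \sum_(i < n) x ord0 i * y ord0 i <= enorm x * enorm y.
Proof.
have [p0|p0] := eqVneq (enorm x) 0.
  rewrite p0 mul0r big1// => i _; have := coord_le_enorm x i.
  by rewrite p0 normr_le0 => /eqP ->; rewrite mul0r.
have [q0|q0] := eqVneq (enorm y) 0.
  rewrite q0 mulr0 big1// => i _; have := coord_le_enorm y i.
  by rewrite q0 normr_le0 => /eqP ->; rewrite mulr0.
have pq : 0 < enorm x * enorm y by rewrite mulr_gt0// lt0r enorm_ge0 andbT.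
have : 0 <= \sum_(i < n) (enorm y * x ord0 i - enorm x * y ord0 i) ^+ 2.
  by apply: sumr_ge0 => i _; exact: sqr_ge0.
have -> : \sum_(i < n) (enorm y * x ord0 i - enorm x * y ord0 i) ^+ 2 =
    2 * (enorm x * enorm y) *
      (enorm x * enorm y - \sum_(i < n) x ord0 i * y ord0 i).
  rewrite (eq_bigr (fun i => enorm y ^+ 2 * x ord0 i ^+ 2 +
    enorm x ^+ 2 * y ord0 i ^+ 2 -
    2 * (enorm x * enorm y) * (x ord0 i * y ord0 i))); last first.
    by move=> i _; ring.
  rewrite big_split/= sumrN big_split/= -!mulr_sumr -!enorm_sqr; ring.
by rewrite pmulr_rge0 ?subr_ge0// mulr_gt0.
Qed.

Lemma ler_enormD x y : enorm (x + y) <= enorm x + enorm y.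
Proof.
rewrite -(@ler_pXn2r _ 2) ?nnegrE ?addr_ge0 ?enorm_ge0// enorm_sqr.
rewrite (eq_bigr (fun i => x ord0 i ^+ 2 + y ord0 i ^+ 2 +
    2 * (x ord0 i * y ord0 i))); last by move=> i _; rewrite mxE; ring.
rewrite !big_split/= -mulr_sumr -!enorm_sqr.
have := enorm_cauchy_schwarz x y; nra.
Qed.

Lemma ler_enorm_dist y x z : enorm (x - z) <= enorm (x - y) + enorm (y - z).
Proof. by rewrite -[x - z](subrKA y) ler_enormD. Qed.

Lemma norm_le_enorm x : `|x| <= enorm x.
Proof.
rewrite [`|x|]mx_normrE; apply: bigmax_le; first exact: enorm_ge0.
by move=> [i j] _ /=; rewrite (ord1 i) coord_le_enorm.
Qed.

Lemma enorm_le_norm x : enorm x <= n%:R * `|x|.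
Proof.
rewrite -(@ler_pXn2r _ 2) ?nnegrE ?enorm_ge0 ?mulr_ge0 ?ler0n// enorm_sqr.
apply: (@le_trans _ _ (\sum_(i < n) `|x| ^+ 2)).
  apply: ler_sum => i _; rewrite -[x ord0 i ^+ 2]real_normK ?num_real//.
  rewrite ler_pXn2r ?nnegrE// [leRHS]mx_normrE.
  exact: (le_bigmax _ (fun ij : 'I_1 * 'I_n => `|x ij.1 ij.2|) (ord0, i)).
rewrite sumr_const card_ord -[leLHS]mulr_natl exprMn ler_wpM2r ?sqr_ge0//.
by rewrite -natrX ler_nat; case: n => // m; rewrite expnS leq_pmulr.
Qed.

(** The neighbourhoods of 'rV[R]_n come from the sup norm, which is equivalent
  to the Euclidean one. *)
Lemma near_enorm x (e : R) : 0 < e -> \forall y \near x, enorm (y - x) < e.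
Proof.
move=> e0; have n1 : 0 < n%:R + 1 :> R by rewrite ltr_wpDl.
apply/nbhs_normP; exists (e / (n%:R + 1)); first by rewrite /= divr_gt0.
move=> y /=; rewrite ltr_pdivlMr// distrC => h.
apply: le_lt_trans (enorm_le_norm _) _; apply: le_lt_trans h.
by rewrite mulrC ler_wpM2l// lerDl.
Qed.

End Enorm.

(** * Upper semicontinuous functions on a set *)

Lemma closure_bounded (K : realFieldType) (V : normedModType K) (A : set V) :
  bounded_set A -> bounded_set (closure A).
Proof.
move=> [M0 [M0r AM0]]; exists M0; split=> // M /AM0 AM x clAx /=.
apply/ler_addgt0Pr => e e0.
have [y [Ay]] := clAx _ (nbhsx_ballx x e e0).
rewrite -ball_normE /= => xy; rewrite -[x](subrK y).
apply: le_trans (ler_normD _ _) _; rewrite addrC lerD ?(ltW xy)//.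
exact: AM.
Qed.


Section Usc.
Variables (R : realType) (T : topologicalType).
Implicit Types (A B : set T) (u w : T -> R).

(** Trades the subspace topology for neighbourhoods in the ambient space; the
  points outside A, isolated in the subspace, impose no condition. *)
Lemma usc_onP A u : usc_on A u <->
  forall x, A x -> forall a, u x < a -> \forall y \near x, A y -> u y < a.
Proof.
split=> [h x Ax a uxa|h x a].
  have [|V + hV] := h (x : subspace A) (- a); first by rewrite lte_fin ltrN2.
  rewrite /nbhs/= -nbhs_subspace_in// => nV.
  have {}nV : \forall y \near x, A y -> V y by exact: nV.
  by apply: filterS nV => y Vy Ay; have := hV _ (Vy Ay); rewrite lte_fin ltrN2.
rewrite lte_fin ltrNr => uxa; have [Ax|nAx] := pselect (A x).
  exists [set y | A y /\ u y < - a] => [|y [_ /=]]; last first.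
    by rewrite lte_fin ltrNr.
  rewrite /nbhs/= -nbhs_subspace_in//.
  by apply: filterS (h _ Ax _ uxa) => y hy Ay; split=> //; exact: hy.
exists [set x] => [|y ->]; last by rewrite lte_fin ltrNr.
by rewrite /nbhs/= -nbhs_subspace_out.
Qed.

Lemma usc_onS A B u : B `<=` A -> usc_on A u -> usc_on B u.
Proof.
move=> BA /usc_onP h; apply/usc_onP => x /BA Ax a /(h _ Ax).
by apply: filterS => y hy /BA.
Qed.

Lemma usc_onD A u w : usc_on A u -> usc_on A w -> usc_on A (u \+ w).
Proof.
move=> /usc_onP hu /usc_onP hw; apply/usc_onP => x Ax a /= uwa.
have e0 : 0 < (a - (u x + w x)) / 2 by lra.
near=> y => Ay.
have : u y < u x + (a - (u x + w x)) / 2.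
  by move: Ay; near: y; apply: hu => //; lra.
have : w y < w x + (a - (u x + w x)) / 2.
  by move: Ay; near: y; apply: hw => //; lra.
lra.
Unshelve. all: end_near. Qed.

Lemma usc_closed A u (c : R) : closed A -> usc_on A u ->
  closed [set x | A x /\ c <= u x].
Proof.
move=> cA /usc_onP hu x hx.
have Ax : A x by apply: cA => U /hx [y [[Ay _] Uy]]; exists y.
split=> //; rewrite leNgt; apply/negP => /(hu _ Ax) /hx [y [[Ay cuy]]].
by move=> /(_ Ay); rewrite ltNge cuy.
Qed.

(** If no point were a maximum, every x in A would lie in a set where u < u b
  for some b in A. Compactness extracts a single b valid for all of A, and x = b
  is absurd. *)
Lemma usc_attains_max A u : compact A -> A !=set0 -> usc_on A u ->
  exists2 x, A x & forall y, A y -> u y <= u x.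
Proof.
move=> cA [a0 Aa0] /usc_onP hu; apply: contrapT => nmax.
have up x : A x -> exists2 y, A y & u x < u y.
  move=> Ax; apply: contrapT => ny; apply: nmax; exists x => // y Ay.
  by rewrite leNgt; apply/negP => xy; apply: ny; exists y.
(* The filter of the properties that hold once u b is large enough. *)
pose F : set_system T :=
  [set S | exists2 a, A a & forall b, A b -> u a <= u b -> S b].
have FF : Filter F.
  split=> [|S1 S2 [a Aa ha] [b Ab hb]|S1 S2 sub [a Aa ha]].
  - by exists a0.
  - have [ab|/ltW ba] := leP (u a) (u b).
      by exists b => // c Ac bc; split; [exact: ha (le_trans ab bc)|exact: hb].
    by exists a => // c Ac bc; split; [exact: ha|exact: hb (le_trans ba bc)].
  - by exists a => // b Ab /(ha _ Ab)/sub.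
move/compact_near_coveringP/(_ _ F (fun b x => A x -> u x < u b) FF) : cA.
case=> [x Ax|a Aa ha].
  have [b Ab xb] := up _ Ax.
  exists ([set y | A y -> u y < u b], [set c | u b <= u c]) => /=.
    by split; [exact: hu|exists b].
  by move=> [y c] /= [hy bc] Ay; exact: lt_le_trans (hy Ay) bc.
by have := ha _ Aa (lexx _) _ Aa Aa; rewrite ltxx.
Qed.

End Usc.

(** * Paths and the path distance *)

Section PathLength.
Variables (R : realType) (n : nat).
Implicit Types (g : R -> 'rV[R]_n) (l : R -> R) (s : seq R).

(** The function l is an upper estimate of the arc length of g between two
  parameters. A path has length at most L exactly when some l with
  l 1 - l 0 <= L is such an estimate; unlike suprema over partitions, these
  functions are reversed and glued together as easily as the paths. *)
Definition arc_bound g l := forall s t : R,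
  0 <= s -> s <= t -> t <= 1 -> enorm (g t - g s) <= l t - l s.

Lemma path_variation_ge0 g s : 0 <= path_variation g s.
Proof. by apply: sumr_ge0 => i _; exact: enorm_ge0. Qed.

Lemma path_variation_rcons g s (t : R) :
  path_variation g (rcons s t) =
  path_variation g s + enorm (g t - g (last 0 s)).
Proof.
rewrite /path_variation size_rcons big_ord_recr/=; congr (_ + _).
  apply: eq_bigr => i _; rewrite nth_rcons ltn_ord -rcons_cons nth_rcons/=.
  by rewrite ltnS ltnW.
rewrite nth_rcons ltnn eqxx -rcons_cons nth_rcons/= ltnSn.
by rewrite (last_nth 1).
Qed.

Lemma path_length_le_arc_bound g l : arc_bound g l ->
  (path_length g <= (l 1 - l 0)%:E)%E.
Proof.
move=> gl; apply/ereal_supP => _ [s ps <-]; rewrite lee_fin.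
pose p := nth 1 (0 :: s).
apply: (@le_trans _ _ (\sum_(i < size s) (l (p i.+1) - l (p i)))).
  apply: ler_sum => i _; apply: gl.
  - by apply: (itv_partition_nth_ge _ ps); rewrite ltnS ltnW.
  - by case: ps => /(pathP 1) h _; exact/ltW/h.
  - by apply: (@itv_partition_nth_le _ _ 0 1 s i.+1 _ ps); rewrite ltnS.
rewrite -(big_mkord xpredT (fun i => l (p i.+1) - l (p i))).
by rewrite telescope_sumr// /p (itv_partition_nth_size _ ps).
Qed.

(** The estimate l t is the arc length itself: the supremum of the variation
  of g over the partitions of [0, t]. Adding the point t to a partition of [0, s]
  gives one of [0, t] and adds |g t - g s| to the variation. *)
Lemma arc_bound_of_path_length g (L : R) : (path_length g <= L%:E)%E ->
  exists2 l, arc_bound g l & l 1 - l 0 <= L.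
Proof.
move=> gL.
have pvL s : itv_partition 0 1 s -> path_variation g s <= L.
  by move=> ps; rewrite -lee_fin; apply: le_trans gL; apply: ereal_sup_ubound;
     exists s.
pose S t := [set path_variation g s | s in itv_partition 0 t].
have extend t t' s : t < t' -> itv_partition 0 t s ->
    itv_partition 0 t' (rcons s t').
  move=> tt' [ps /eqP ls]; split; last by rewrite last_rcons.
  by rewrite rcons_path ps ls.
have SL t : t <= 1 -> ubound (S t) L.
  rewrite le_eqVlt => /predU1P[->|t1] _ [s ps <-]; first exact: pvL.
  have := pvL _ (extend _ _ _ t1 ps); rewrite path_variation_rcons.
  by apply: le_trans; rewrite lerDl enorm_ge0.
have S_neq0 t : 0 <= t -> S t !=set0.
  rewrite le_eqVlt => /predU1P[<-|t0].
    by exists (path_variation g [::]), [::] => //; split.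
  by exists (path_variation g [:: t]), [:: t] => //; exact: itv_partition1.
have Ssup t : 0 <= t -> t <= 1 -> has_sup (S t).
  by move=> t0 t1; split; [exact: S_neq0|exists L; exact: SL].
exists (sup \o S) => [s t s0 st t1|] /=; last first.
  have S0 : 0 <= sup (S 0).
    have [y Sy] := S_neq0 0 (lexx _); apply: (@le_trans _ _ y).
      by case: Sy => s _ <-; exact: path_variation_ge0.
    by apply: ub_le_sup => //; case: (Ssup 0 (lexx _) ler01).
  have : sup (S 1) <= L by apply: ge_sup; [exact: S_neq0|exact: SL].
  lra.
move: st; rewrite le_eqVlt => /predU1P[->|st].
  by rewrite !subrr enorm0.
rewrite lerBrDr -lerBrDl; apply: ge_sup; first exact: S_neq0.
move=> _ [r pr <-]; rewrite lerBrDl addrC.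
have -> : path_variation g r + enorm (g t - g s) =
    path_variation g (rcons r t).
  by case: pr => _ /eqP rs; rewrite path_variation_rcons rs.
apply: ub_le_sup; last by exists (rcons r t) => //; exact: extend pr.
by case: (Ssup t (le_trans s0 (ltW st)) t1).
Qed.

End PathLength.

Section PathDist.
Variables (R : realType) (n : nat) (Omega : set 'rV[R]_n).
Implicit Types (x y z : 'rV[R]_n) (L : R).

(** Encoded by arc length estimates rather than by path_length, so that no
  supremum has to be computed for reversed and glued paths. *)
Definition joined x y L := exists g l,
  [/\ lipschitz_path g, (forall t, `[0, 1]%classic t -> closure Omega (g t)),
      g 0 = x, g 1 = y & arc_bound g l /\ l 1 - l 0 <= L].

Lemma path_dist_le_joined x y L : joined x y L ->
  (path_dist Omega x y <= L%:E)%E.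
Proof.
move=> [g [l [gL gO g0 g1 [gl lL]]]].
apply: (@le_trans _ _ (path_length g)); first by apply: ereal_inf_lbound; exists g.
by apply: le_trans (path_length_le_arc_bound gl) _; rewrite lee_fin.
Qed.

Lemma joined_of_path_dist_lt x y L : (path_dist Omega x y < L%:E)%E ->
  joined x y L.
Proof.
move=> /ereal_inf_lt [_ [g [gL gO g0 g1] <-]] /ltW gl.
by have [l ? ?] := arc_bound_of_path_length gl; exists g, l; split.
Qed.

Lemma enorm_le_path_dist x y : ((enorm (y - x))%:E <= path_dist Omega x y)%E.
Proof.
apply/ereal_infP => _ [g [_ _ <- <-] <-]; apply: ereal_sup_ubound.
exists [:: 1]; first exact: itv_partition1.
by rewrite /path_variation big_ord_recl big_ord0/= addr0.
Qed.

Lemma path_dist_ge0 x y : (0 <= path_dist Omega x y)%E.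
Proof. by apply: le_trans (enorm_le_path_dist x y); rewrite lee_fin enorm_ge0. Qed.

Lemma joinedC x y L : joined x y L -> joined y x L.
Proof.
move=> [g [l [[k gk] gO g0 g1 [gl lL]]]].
exists (fun t => g (1 - t)), (fun t => - l (1 - t)).
have flip (t : R) : `[0, 1]%classic t -> `[0, 1]%classic (1 - t).
  by rewrite /= !in_itv/= => /andP[? ?]; apply/andP; split; lra.
split; rewrite ?subr0 ?subrr//.
- exists k => s t s01 t01.
  have -> : s - t = - ((1 - s) - (1 - t)) by ring.
  by rewrite normrN; apply: gk; exact: flip.
- by move=> t /flip; exact: gO.
- split=> [s t s0 st t1|]; last lra.
  have := gl (1 - t) (1 - s); rewrite enormBC.
  move=> /(_ _ _ _)/le_trans; apply; lra.
Qed.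

(** The two paths are run through at double speed on [0, 1/2] and [1/2, 1]; a
  pair of parameters on either side of 1/2 is handled by the triangle inequality
  at the junction y. *)
Lemma joined_trans y x z L M : joined x y L -> joined y z M ->
  joined x z (L + M).
Proof.
move=> [g [l [[k gk] gO g0 g1 [gl lL]]]] [h [m [[k' hk] hO h0 h1 [hm mM]]]].
pose f (t : R) := if t <= 2^-1 then g (2 * t) else h (2 * t - 1).
(* The estimate for the second path is shifted to agree with the first one at
   the junction. *)
pose c (t : R) := if t <= 2^-1 then l (2 * t)
  else l 1 - m 0 + m (2 * t - 1).
have f12 : f 2^-1 = y by rewrite /f lexx divff.
have fl s t : s <= t -> t <= 2^-1 -> f t - f s = g (2 * t) - g (2 * s).
  by move=> st t2; rewrite /f t2 (le_trans st t2).
have fr s t : 2^-1 <= s -> s <= t -> f t - f s = h (2 * t - 1) - h (2 * s - 1).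
  have fh r : 2^-1 <= r -> f r = h (2 * r - 1).
    rewrite le_eqVlt => /predU1P[<-|r2]; first by rewrite f12 divff// subrr h0.
    by rewrite /f leNgt r2.
  by move=> s2 st; rewrite !fh// (le_trans s2 st).
have unitP (t : R) : `[0, 1]%classic t = (0 <= t <= 1) :> Prop.
  by rewrite /= in_itv.
exists f, c; split.
- exists (2 * (`|k| + `|k'|)).
  have lip s t : 0 <= s -> s <= t -> t <= 1 ->
      enorm (f t - f s) <= 2 * (`|k| + `|k'|) * (t - s).
    move=> s0 st t1; have [ak ak'] := (ler_norm k, ler_norm k').
    have [bk bk'] := (normr_ge0 k, normr_ge0 k').
    have lip_l a b : 0 <= a -> a <= b -> b <= 2^-1 ->
        enorm (f b - f a) <= 2 * (`|k| + `|k'|) * (b - a).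
      move=> a0 ab b2; rewrite fl//; apply: le_trans (gk _ _ _ _) _.
      + by rewrite unitP; apply/andP; split; lra.
      + by rewrite unitP; apply/andP; split; lra.
      + rewrite ger0_norm; last lra. nra.
    have lip_r a b : 2^-1 <= a -> a <= b -> b <= 1 ->
        enorm (f b - f a) <= 2 * (`|k| + `|k'|) * (b - a).
      move=> a2 ab b1; rewrite fr//; apply: le_trans (hk _ _ _ _) _.
      + by rewrite unitP; apply/andP; split; lra.
      + by rewrite unitP; apply/andP; split; lra.
      + rewrite ger0_norm; last lra. nra.
    have [t2|t2] := leP t 2^-1; first exact: lip_l.
    have [s2|s2] := leP 2^-1 s; first exact: lip_r.
    apply: le_trans (ler_enorm_dist (f 2^-1) _ _) _.
    have := lip_l s 2^-1 s0 (ltW s2) (lexx _).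
    have := lip_r 2^-1 t (lexx _) (ltW t2) t1.
    lra.
  move=> s t; rewrite !unitP => /andP[s0 s1] /andP[t0 t1].
  have [st|/ltW ts] := leP s t.
    by rewrite enormBC distrC [`|t - s|]ger0_norm ?subr_ge0// lip.
  by rewrite [`|s - t|]ger0_norm ?subr_ge0// lip.
- move=> t; rewrite unitP /f => /andP[t0 t1]; case: ifP => t2.
    by apply: gO; rewrite unitP; apply/andP; split; lra.
  by apply: hO; rewrite unitP; apply/andP; split; lra.
- by rewrite /f invr_ge0 ler0n mulr0.
- rewrite /f ifF; last by apply/negbTE; rewrite -ltNge; lra.
  by have -> : 2 * 1 - 1 = 1 :> R by lra.
- split; last first.
    rewrite /c invr_ge0 ler0n mulr0 ifF; last first.
      by apply/negbTE; rewrite -ltNge; lra.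
    have -> : 2 * 1 - 1 = 1 :> R by lra.
    lra.
  have cr r : 2^-1 <= r -> c r = l 1 - m 0 + m (2 * r - 1).
    rewrite le_eqVlt => /predU1P[<-|r2]; last by rewrite /c leNgt r2.
    by rewrite /c lexx divff// subrr subrK.
  have cl r : r <= 2^-1 -> c r = l (2 * r) by move=> r2; rewrite /c r2.
  have arc_l a b : 0 <= a -> a <= b -> b <= 2^-1 ->
      enorm (f b - f a) <= c b - c a.
    move=> a0 ab b2; rewrite fl// !cl ?(le_trans ab)//; apply: gl; lra.
  have arc_r a b : 2^-1 <= a -> a <= b -> b <= 1 ->
      enorm (f b - f a) <= c b - c a.
    move=> a2 ab b1; rewrite fr// !cr ?(le_trans a2)//.
    have := hm (2 * a - 1) (2 * b - 1) => /(_ _ _ _)/le_trans; apply; lra.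
  move=> s t s0 st t1.
  have [t2|t2] := leP t 2^-1; first exact: arc_l.
  have [s2|s2] := leP 2^-1 s; first exact: arc_r.
  apply: le_trans (ler_enorm_dist (f 2^-1) _ _) _.
  have := arc_l s 2^-1 s0 (ltW s2) (lexx _).
  have := arc_r 2^-1 t (lexx _) (ltW t2) t1.
  lra.
Qed.

Lemma joined_segment x y :
  (forall t, 0 <= t <= 1 -> closure Omega (x + t *: (y - x))) ->
  joined x y (enorm (y - x)).
Proof.
move=> seg; exists (fun t => x + t *: (y - x)), (fun t => t * enorm (y - x)).
have E (s t : R) : enorm (x + t *: (y - x) - (x + s *: (y - x))) =
    `|t - s| * enorm (y - x).
  by rewrite -enormZ scalerBl; congr enorm; rewrite opprD addrACA subrr add0r.
split.
- by exists (enorm (y - x)) => s t _ _; rewrite E mulrC.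
- by move=> t; rewrite /= in_itv/=; exact: seg.
- by rewrite scale0r addr0.
- by rewrite scale1r addrC subrK.
- split; last by rewrite mul0r mul1r subr0.
  by move=> s t _ st _; rewrite E ger0_norm ?subr_ge0// mulrBl.
Qed.

(** Transports constructions on paths to distances: an infimum need not be
  attained, so the comparison is made for all L above it. *)
Lemma path_dist_transfer x y x' y' (e : R) :
  (forall L, joined x' y' L -> joined x y (L + e)) ->
  (path_dist Omega x y <= path_dist Omega x' y' + e%:E)%E.
Proof.
move=> xy; have := path_dist_ge0 x' y'.
case E : (path_dist Omega x' y') => [r| |] // _; last by rewrite leey.
rewrite -EFinD; apply/lee_addgt0Pr => d d0; rewrite -EFinD.
have /xy : joined x' y' (r + d).
  by apply: joined_of_path_dist_lt; rewrite E lte_fin ltrDl.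
by rewrite addrAC; exact: path_dist_le_joined.
Qed.

Lemma path_distC x y : path_dist Omega x y = path_dist Omega y x.
Proof.
suff le a b : (path_dist Omega a b <= path_dist Omega b a)%E.
  by apply/eqP; rewrite eq_le !le.
rewrite -[leRHS]adde0; apply: path_dist_transfer => L.
by rewrite addr0; exact: joinedC.
Qed.

(** For z in a ball around x inside Omega, the segment from z to x is an
  admissible path. The bound fails in general at boundary points, where that
  segment may leave the closure of Omega. *)
Lemma path_dist_le_near x y : open Omega -> Omega x ->
  \forall z \near x,
    (path_dist Omega y x <= path_dist Omega y z + (enorm (x - z))%:E)%E.
Proof.
move=> oO Ox; have /nbhs_normP[r /= r0 rO] : nbhs x Omega by exact: open_nbhs_nbhs.
apply/nbhs_normP; exists r => //= z /= xz.
apply: path_dist_transfer => L yz; apply: (joined_trans yz).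
apply: joined_segment => t /andP[t0 t1]; apply: subset_closure; apply: rO => /=.
have -> : x - (z + t *: (x - z)) = (1 - t) *: (x - z).
  by rewrite scalerBl scale1r opprD addrA.
rewrite normrZ ger0_norm ?subr_ge0//; apply: le_lt_trans xz.
by rewrite ler_piMl// lerBlDr lerDl.
Qed.

End PathDist.

(** * Slopes at the maxima of u - v *)

Section Comparison.
Variables (R : realType) (n : nat) (Omega : set 'rV[R]_n) (eps : R).
Hypotheses (Omega_open : open Omega) (Omega_compact : compact (closure Omega)).
Hypotheses (Omega_diam : (path_diam Omega < +oo)%E) (eps_gt0 : 0 < eps).
Implicit Types (u v : 'rV[R]_n -> R) (x y z : 'rV[R]_n).

Local Notation closedOmega := (closure Omega).

Lemma path_dist_fin_num x y : closedOmega x -> closedOmega y ->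
  path_dist Omega x y \is a fin_num.
Proof.
move=> Ox Oy; rewrite ge0_fin_numE ?path_dist_ge0//; apply: le_lt_trans Omega_diam.
by apply: ereal_sup_ubound; exists (x, y).
Qed.

Lemma path_distxx x : closedOmega x -> path_dist Omega x x = 0%E.
Proof.
move=> Ox; apply/eqP; rewrite eq_le path_dist_ge0 andbT.
have : joined Omega x x (enorm (x - x)).
  by apply: joined_segment => t _; rewrite subrr scaler0 addr0.
by rewrite subrr enorm0; exact: path_dist_le_joined.
Qed.

(** The distance to y is lower semicontinuous on F, as F lies inside Omega, and
  so attains its minimum over the compact set F. *)
Lemma nearest_point (F : set 'rV[R]_n) y : compact F -> F `<=` Omega ->
  F !=set0 -> closedOmega y -> (dist_to Omega y F <= eps%:E)%E ->
  exists2 x, F x & (path_dist Omega y x <= eps%:E)%E.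
Proof.
move=> cF FO F0 Oy dyF.
have FcO : F `<=` closedOmega by move=> z /FO; exact: subset_closure.
have : usc_on F (fun x => - fine (path_dist Omega y x)).
  apply/usc_onP => x Fx a xa.
  have e0 : 0 < a + fine (path_dist Omega y x) by lra.
  near=> z => Fz.
  have h : (path_dist Omega y x <= path_dist Omega y z + (enorm (x - z))%:E)%E.
    by near: z; apply: path_dist_le_near => //; exact: FO.
  have : enorm (z - x) < a + fine (path_dist Omega y x).
    by near: z; exact: near_enorm.
  move: h; rewrite -(fineK (path_dist_fin_num Oy (FcO _ Fx))).
  rewrite -(fineK (path_dist_fin_num Oy (FcO _ Fz))) -EFinD lee_fin enormBC /=.
  lra.
move=> /(usc_attains_max cF F0) [x Fx xmin]; exists x => //.
apply: le_trans dyF; apply/ereal_infP => _ [z Fz <-].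
rewrite -(fineK (path_dist_fin_num Oy (FcO _ Fx))).
rewrite -(fineK (path_dist_fin_num Oy (FcO _ Fz))) lee_fin.
by rewrite -lerN2 xmin.
Unshelve. all: end_near. Qed.

Lemma rho_le_eps x y : path_ball Omega x eps y -> rho Omega eps x y <= eps.
Proof.
move=> [Oy xy].
have d_eps : fine (path_dist Omega x y) <= eps.
  move: (path_dist_ge0 Omega x y) xy.
  by case: (path_dist Omega x y) => [r| |] //; rewrite lee_fin.
by rewrite /rho; case: ifP => // _; rewrite ge_max d_eps lexx.
Qed.

(** When y is on the boundary, rho is the distance from x to y, which is at
  least the radius of a ball around x contained in Omega. *)
Lemma rho_bounded_below x : Omega x ->
  exists2 c : R, 0 < c & forall y, path_ball Omega x eps y -> c <= rho Omega eps x y.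
Proof.
move=> Ox; have /nbhs_normP[r /= r0 rO] : nbhs x Omega by exact: open_nbhs_nbhs.
exists (Num.min r eps); first by rewrite lt_min r0.
move=> y [Oy xy]; rewrite /rho (mem_set Ox)/=; case: ifPn => yO.
  by rewrite le_max ge_min ge_min lexx !orbT.
have Ocx : closedOmega x by exact: subset_closure.
rewrite ge_min; apply/orP; left; rewrite leNgt; apply/negP => dr.
move/negP : yO; apply; apply/mem_set/rO => /=; rewrite distrC.
apply: le_lt_trans (norm_le_enorm _) _; apply: le_lt_trans dr.
by rewrite -lee_fin (fineK (path_dist_fin_num Ocx Oy)) enorm_le_path_dist.
Qed.

Lemma rho_gt0 x y : Omega x -> path_ball Omega x eps y ->
  0 < rho Omega eps x y.
Proof. by move=> /rho_bounded_below[c c0 h] /h; exact: lt_le_trans. Qed.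

Lemma slope_minusE u x :
  slope_minus Omega eps u x = slope_plus Omega eps (\- u) x.
Proof.
congr ereal_sup; apply: eq_imagel => y _ /=.
by rewrite opprK addrC.
Qed.

Lemma slope_plus_ge0 u x : Omega x -> (0 <= slope_plus Omega eps u x)%E.
Proof.
move=> Ox; apply: ereal_sup_ubound; exists x; last by rewrite subrr mul0r.
have Ocx : closedOmega x by exact: subset_closure.
by split=> //; rewrite path_distxx// lee_fin ltW.
Qed.

(** An upper semicontinuous function is bounded above on the compact closure,
  and rho is bounded away from 0. *)
Lemma slope_plus_lty u x : usc_on closedOmega u -> Omega x ->
  (slope_plus Omega eps u x < +oo)%E.
Proof.
move=> uu Ox; have [c c0 hc] := rho_bounded_below Ox.
have Ocx : closedOmega x by exact: subset_closure.
have [b _ hb] := usc_attains_max Omega_compact (ex_intro _ x Ocx) uu.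
apply: (@le_lt_trans _ _ ((u b - u x) / c)%:E); last exact: ltry.
apply/ereal_supP => _ [y xy <-]; rewrite lee_fin.
have ub : u y - u x <= u b - u x by rewrite lerB// hb//; case: xy.
apply: (@le_trans _ _ ((u b - u x) / rho Omega eps x y)).
  by rewrite ler_pM2r// invr_gt0 rho_gt0.
by rewrite ler_wpM2l ?subr_ge0 ?hb// lef_pV2 ?posrE ?rho_gt0// hc.
Qed.

Lemma slope_plus_le_at_max u v x : Omega x ->
  (forall y, closedOmega y -> u y - v y <= u x - v x) ->
  (slope_plus Omega eps u x <= slope_plus Omega eps v x)%E.
Proof.
move=> Ox xmax; apply/ereal_supP => _ [y xy <-].
apply: (@le_trans _ _ ((v y - v x) / rho Omega eps x y)%:E); last first.
  by apply: ereal_sup_ubound; exists y.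
rewrite lee_fin ler_pM2r ?invr_gt0 ?rho_gt0//.
by have [Oy _] := xy; have := xmax y Oy; lra.
Qed.

(** Maximality orders the upward slopes one way and the downward slopes the
  other way; the Laplacian inequality is compatible with this only if all four
  slopes are finite and the two inequalities are equalities. *)
Lemma slopes_eq_at_max u v x : usc_on closedOmega u ->
  usc_on closedOmega (\- v) -> Omega x ->
  (- inf_laplace Omega eps u x <= - inf_laplace Omega eps v x)%E ->
  (forall y, closedOmega y -> u y - v y <= u x - v x) ->
  slope_plus Omega eps u x = slope_plus Omega eps v x /\
  slope_minus Omega eps u x = slope_minus Omega eps v x.
Proof.
move=> uu vu Ox; rewrite /inf_laplace !slope_minusE => + xmax.
have := slope_plus_le_at_max Ox xmax.
have : (slope_plus Omega eps (\- v)%R x <= slope_plus Omega eps (\- u)%R x)%E.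
  by apply: slope_plus_le_at_max => // y /xmax /=; lra.
have := slope_plus_lty uu Ox; have := slope_plus_ge0 u Ox.
have := slope_plus_lty vu Ox; have := slope_plus_ge0 (\- v) Ox.
have := slope_plus_ge0 v Ox; have := slope_plus_ge0 (\- u) Ox.
have k0 : 0 < eps^-1 by rewrite invr_gt0.
(* If the downward slope of u or the upward slope of v is infinite, the
   Laplacian inequality reads +oo <= r or r <= -oo with r finite, or
   +oo <= -oo. *)
case: (slope_plus Omega eps u x) => [a| |]//;
case: (slope_plus Omega eps v x) => [c| |]//;
case: (slope_plus Omega eps (\- u) x) => [b| |]//;
case: (slope_plus Omega eps (\- v) x) => [d| |]//= _ _ _ _ _ _;
  rewrite ?gt0_muley ?gt0_muleNy ?lte_fin//=.
rewrite !lee_fin => db ac h; have := h.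
rewrite lerN2 ler_pM2l// => h'.
by split; congr EFin; lra.
Qed.

(** Let s > 0 be the slope of u at x. The points whose difference quotient
  exceeds s / 2 lie in a compact set K on which u > u x. If K contained no maximum
  point of u - v, then u - v would fall short of its maximum by some d > 0 on K.
  Each quotient of v would exceed the matching quotient of u by at least d / eps,
  since rho <= eps, and so the slope of v would exceed s. *)
Lemma slope_plus_ascent u v x : usc_on closedOmega u ->
  usc_on closedOmega (\- v) -> Omega x ->
  (forall y, closedOmega y -> u y - v y <= u x - v x) ->
  (slope_plus Omega eps v x <= slope_plus Omega eps u x)%E ->
  (0 < slope_plus Omega eps v x)%E ->
  exists z, [/\ closedOmega z, u z - v z = u x - v x & u x < u z].
Proof.
move=> uu vu Ox xmax vleu v_gt0; apply: contrapT => no_ascent.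
have [c c0 hc] := rho_bounded_below Ox.
have := slope_plus_lty uu Ox; have := lt_le_trans v_gt0 vleu.
case Es : (slope_plus Omega eps u x) vleu => [s| |]// vleu; rewrite lte_fin => s0 _.
pose K := [set z | closedOmega z /\ u x + s / 2 * c <= u z].
have cK : compact K.
  apply: (subclosed_compact _ Omega_compact); last by move=> z [].
  exact: usc_closed (@closed_closure _ Omega) uu.
have quotK y : path_ball Omega x eps y -> s / 2 < (u y - u x) / rho Omega eps x y ->
    K y.
  move=> xy; rewrite ltr_pdivlMr ?rho_gt0// => h; split; first by case: xy.
  have := hc _ xy; nra.
have gap : exists2 d : R, 0 < d & forall z, K z -> u z - v z <= u x - v x - d.
  have KO : K `<=` closedOmega by move=> z [].
  have [K0|/set0P K0] := eqVneq K set0.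
    by exists 1 => // z; rewrite K0.
  have [z Kz zmax] := usc_attains_max cK K0 (usc_onS KO (usc_onD uu vu)).
  exists ((u x - v x) - (u z - v z)) => [|y /zmax /=]; last lra.
  have [Oz uz] := Kz; rewrite subr_gt0 lt_neqAle xmax// andbT.
  apply/negP => /eqP uvz; apply: no_ascent; exists z; split=> //.
  by apply: lt_le_trans uz; rewrite ltrDl mulr_gt0// divr_gt0.
have [d d0 hd] := gap.
(* A quotient above s / 2 puts y in K; one above s - d / eps contradicts the
   bound s on the slope of v. *)
have : ((Num.max (s / 2) (s - d / eps))%:E < slope_plus Omega eps u x)%E.
  rewrite Es lte_fin gt_max ltrBlDr ltrDl divr_gt0// andbT; lra.
move=> /ereal_sup_gt[_ [y xy <-]].
rewrite lte_fin gt_max => /andP[/(quotK _ xy) Ky sy].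
suff : (s%:E < slope_plus Omega eps v x)%E by rewrite ltNge vleu.
apply: (@lt_le_trans _ _ ((v y - v x) / rho Omega eps x y)%:E); last first.
  by apply: ereal_sup_ubound; exists y.
rewrite lte_fin.
apply: (@lt_le_trans _ _ ((u y - u x) / rho Omega eps x y + d / eps)).
  by rewrite -ltrBlDr.
have dr : d / eps <= d / rho Omega eps x y.
  by rewrite ler_pM2l// lef_pV2 ?posrE ?rho_gt0// rho_le_eps.
apply: le_trans (lerD (lexx _) dr) _.
rewrite -mulrDl ler_pM2r ?invr_gt0 ?rho_gt0//.
by have := hd _ Ky; lra.
Qed.

(** Equality of the upward slopes is the only information kept from the
  Laplacians, so that the lemma also applies to (- v, - u), for which it is the
  equality of the downward slopes of u and v. *)
Lemma max_on_boundary u v : Omega !=set0 -> usc_on closedOmega u ->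
  usc_on closedOmega (\- v) ->
  (forall x, Omega x -> (forall y, closedOmega y -> u y - v y <= u x - v x) ->
    slope_plus Omega eps u x = slope_plus Omega eps v x) ->
  (forall x, Omega x -> ~ strict_local_max Omega eps u x) ->
  exists2 x, boundary Omega x &
    forall y, closedOmega y -> u y - v y <= u x - v x.
Proof.
move=> [a Oa] uu vu slopeE no_max; apply: contrapT => no_boundary.
have [x0 Ox0 x0max] := usc_attains_max Omega_compact
  (ex_intro _ a (subset_closure Oa)) (usc_onD uu vu).
pose E := [set x | closedOmega x /\ u x0 - v x0 <= u x - v x].
have Emax x y : E x -> closedOmega y -> u y - v y <= u x - v x.
  by move=> [_ Ex] /x0max /= ?; apply: le_trans Ex.
have EO : E `<=` Omega.
  move=> x Ex; apply: contrapT => nOx; apply: no_boundary.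
  exists x; last by move=> y; exact: Emax.
  by split; [case: Ex|move/interior_subset].
have cE : closed E := usc_closed (@closed_closure _ Omega) (usc_onD uu vu).
have Ecl : E `<=` closedOmega by move=> x [].
have [m Em mmax] := usc_attains_max (subclosed_compact cE Omega_compact Ecl)
  (ex_intro _ x0 (conj Ox0 (lexx _))) (usc_onS Ecl uu).
pose F := [set x | E x /\ u m <= u x].
have cF : closed F := usc_closed cE (usc_onS Ecl uu).
have FE : F `<=` E by move=> x [].
have Fm : F m by split.
(* It remains to see that the points near F but outside F have u < u m. *)
apply: (no_max m (EO _ Em)); exists F; split => //.
- by move=> x /FE/EO.
- apply/eqP; rewrite eq_le; apply/andP; split.
    by apply: ereal_sup_ubound; exists m.
  by apply/ereal_supP => _ [z [/mmax zm _] <-]; rewrite lee_fin.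
move=> y [[Oy yF] nFy]; rewrite ltNge; apply/negP => uy.
have nEy : ~ E y by move=> Ey; apply: nFy; split.
have compF : compact F.
  by apply: (subclosed_compact cF Omega_compact) => z /FE/Ecl.
have FO : F `<=` Omega by move=> z /FE/EO.
have [x Fx yx] := nearest_point compF FO (ex_intro _ m Fm) Oy yF.
have Ex := FE _ Fx; have Ox := EO _ Ex.
have xmax z : closedOmega z -> u z - v z <= u x - v x by exact: Emax.
have xy : path_ball Omega x eps y by split=> //; rewrite path_distC.
have ux : u x <= u m by exact: mmax.
have v_gt0 : (0 < slope_plus Omega eps v x)%E.
  apply: (@lt_le_trans _ _ ((v y - v x) / rho Omega eps x y)%:E); last first.
    by apply: ereal_sup_ubound; exists y.
  rewrite lte_fin divr_gt0 ?rho_gt0//.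
  have : u y - v y < u x0 - v x0.
    by rewrite ltNge; apply/negP => ?; apply: nEy; split.
  case: Ex => _; lra.
have [|z [Oz uvz uxz]] := slope_plus_ascent uu vu Ox xmax _ v_gt0.
  by rewrite slopeE.
have /mmax : E z by split=> //; rewrite uvz; case: Ex.
case: Fx => _; lra.
Qed.

End Comparison.

(** * The comparison principle *)

Theorem theorem2p7 (R : realType) (n : nat) (Omega : set 'rV[R]_n)
    (n_gt0 : (0 < n)%N)
    (Omega_neq0 : Omega !=set0) (Omega_open : open Omega)
    (Omega_connected : connected Omega) (Omega_bounded : bounded_set Omega)
    (Omega_diam : (path_diam Omega < +oo)%E)
    (eps : R) (eps_gt0 : 0 < eps) (eps_lt1 : eps < 1)
    (u v : 'rV[R]_n -> R)
    (u_usc : usc_on (closure Omega) u)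
    (v_usc : usc_on (closure Omega) (\- v))
    (le_laplace : forall x, Omega x ->
      (- inf_laplace Omega eps u x <= - inf_laplace Omega eps v x)%E)
    (no_strict :
      (forall x, Omega x -> ~ strict_local_max Omega eps u x) \/
      (forall x, Omega x -> ~ strict_local_min Omega eps v x)) :
  exists m : R,
    is_max_on (closure Omega) (u \- v) m /\
    is_max_on (boundary Omega) (u \- v) m.
Proof.
have Omega_compact : compact (closure Omega).
  exact: bounded_closed_compact (closure_bounded Omega_bounded)
    (@closed_closure _ Omega).
have slopes x (Ox : Omega x) :=
  slopes_eq_at_max Omega_open Omega_compact Omega_diam eps_gt0 u_usc v_usc Ox
    (le_laplace x Ox).
have [x bx xmax] : exists2 x, boundary Omega x &
    forall y, closure Omega y -> u y - v y <= u x - v x.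
  case: no_strict => no_strict.
    by apply: (@max_on_boundary _ _ _ eps) => // x Ox xmax; case: (slopes x Ox xmax).
  have vv_usc : usc_on (closure Omega) (\- (\- u)).
    by move: u_usc; congr usc_on; apply/funext => x /=; rewrite opprK.
  have [|x bx xmax] := max_on_boundary Omega_open Omega_compact Omega_diam
      eps_gt0 Omega_neq0 v_usc vv_usc _ no_strict.
    move=> x Ox xmax; rewrite -!slope_minusE; case: (slopes x Ox) => // y Oy.
    by have /= := xmax y Oy; lra.
  by exists x => // y Oy; have /= := xmax y Oy; lra.
have [Ox _] := bx.
exists (u x - v x); split; split; [by exists x| |by exists x|].
  by move=> _ [y Oy <-]; exact: xmax.
by move=> _ [y [Oy _] <-]; exact: xmax.
Qed.
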